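(* Let $q$ be a fixed complex number with $0<|q|<1$ and let $x,y,z,w\in\mathbb{C}$. (i) If $w\neq 0$, $|xy|<1$, $|y|<1$, $|z|<1$ and $|w|<1$, then $$A(x,y,z,w)=A(z/w,\,w,\,xy,\,y).$$ (ii) If $|x|<1$, $|y|<1$, and $z\neq q^{-r}$, $w\neq q^{-r}$ for all $r\in\mathbb{N}$, then $$A(x,y,z,w)+A(y,x,w,z)=L(x,w)\,L(y,z)+L(xy,z,w).$$
   Context: $\mathbb{N}=\{0,1,2,\dots\}$, and $q$ is complex with $0<|q|<1$. The double Lambert series is $$A(x,y,z,w)=A(x,y,z,w;q):=\sum_{n=0}^\infty\sum_{m\ge n}\frac{x^n y^m}{(1-wq^n)(1-zq^m)},$$ defined for $|xy|<1$, $|y|<1$, $z\ne q^{-r}$, $w\neq q^{-r}$ ($r\in\mathbb{N}$). The Lambert series is $$L(x,y_1,\dots,y_k)=L(x,y_1,\dots,y_k;q):=\sum_{n=0}^\infty\frac{x^n}{(1-y_1q^n)\cdots(1-y_kq^n)},$$ defined for $|x|<1$ and $y_i\ne q^{-r}$ ($r\in\mathbb{N}$). Here $0^0=1$. *)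

(* Defs.v *)
From Stdlib Require Import Reals List.
From Coquelicot Require Import Coquelicot.
Open Scope C_scope.

(** Coquelicot's [Series] is real-valued; [CSeries] is its complex analogue,
    a total function whose value is meaningful only for convergent series
    (see [is_series_CSeries_unique]). *)
Definition CSeries (a : nat -> C) : C :=
  iota (T := C_CompleteNormedModule) (is_series a).

Lemma is_series_CSeries_unique (a : nat -> C) (l : C) :
  is_series a l -> CSeries a = l.
Proof.
  intros H.
  apply (@iota_filterlim_locally C_AbsRing C_CompleteNormedModule nat eventually
           (Proper_StrongProper _ eventually_filter) (@sum_n C_AbelianMonoid a) l).
  exact H.
Qed.

(** The sum of [a m] over [m >= n], in Coquelicot's shifted form. *)
Definition CSeries_from (n : nat) (a : nat -> C) : C :=
  CSeries (fun k => a (n + k)%nat).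

(** [Cpow] satisfies [0 ^ 0 = 1]. *)
Definition double_lambert (q x y z w : C) : C :=
  CSeries (fun n => CSeries_from n (fun m =>
    (x ^ n * y ^ m) / ((1 - w * q ^ n) * (1 - z * q ^ m)))).

Definition Cprod_list (l : list C) : C := fold_right Cmult 1 l.

Definition lambert (q x : C) (ys : list C) : C :=
  CSeries (fun n => x ^ n / Cprod_list (map (fun y => 1 - y * q ^ n) ys)).

(* Main.v *)
Require Import Defs.
From Stdlib Require Import Reals List Lra Lia FunctionalExtensionality.
From Coquelicot Require Import Coquelicot.
Import ListNotations.
Open Scope C_scope.

(** Both identities are rearrangements of absolutely convergent double series.

    (i) Expanding both denominators of [A(x,y,z,w)] geometrically and writing
    [m = n + k] gives the fourfold series
      [sum over n,k,i,j of (xy)^n y^k w^i z^j q^(n i + n j + k j)],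
    in which the exponent of [q] runs over the edges of the path i - n - j - k.
    Reading the path backwards preserves this exponent and turns the parameters
    (w, xy, z, y) at its vertices into (y, z, xy, w), which are those of
    [A(z/w, w, xy, y)].
    The rearrangement is done one edge of the path at a time.  The edge between
    [k] and [j] is the symmetry [L(y,z) = L(z,y)] ([lambert1_sym]), applied to
    the inner sum, which is [y^n L(y, z q^n)] ([lambert_tail]); the middle edge
    is one exchange of summations between [n] and [j] in
    [double_lambert_transform]; the edge between [n] and [i] is
    [lambert1_sym] again.  Each exchange involves terms dominated by a product
    [b n * c m] of summable sequences, so [CSeries_exchange] covers all of them.

    (ii) Put [u n = x^n/(1 - w q^n)] and [v m = y^m/(1 - z q^m)].  The two
    double Lambert series sum [u n * v m] over the triangles [n <= m] and
    [m <= n]; together they cover the square, with the diagonal counted twice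
    ([CSeries_triangles]).  In terms of the tails [U n], [T n] of the two
    series, row and column [n] of the square, from the diagonal onwards,
    contribute
    [u n * T n + v n * U n - u n * v n = U n * T n - U (n+1) * T (n+1)],
    so that the square is summed by telescoping, the products of tails tending
    to 0. *)

(** * Convergence of complex series *)

Lemma sum_n_0_C (a : nat -> C) : sum_n a 0 = a 0%nat :> C.
Proof. exact (sum_O a). Qed.

Lemma sum_n_S_C (a : nat -> C) (N : nat) : sum_n a (S N) = sum_n a N + a (S N) :> C.
Proof. exact (sum_Sn a N). Qed.

(** Reduces complex limits to real ones, where squeezing and the algebra of
    limits are available. *)
Lemma is_series_Cmod (a : nat -> C) (l : C) :
  is_series a l <-> is_lim_seq (fun N => Cmod (sum_n a N - l)) 0.
Proof.
  unfold is_series.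
  rewrite (@filterlim_locally_ball_norm C_AbsRing nat C_NormedModule
             eventually _ (sum_n a) l).
  split; intros H.
  - apply is_lim_seq_spec. intros eps.
    destruct (H eps) as [N HN]. exists N. intros n Hn.
    specialize (HN n Hn).
    rewrite Rminus_0_r, (Rabs_pos_eq _ (Cmod_ge_0 _)). exact HN.
  - apply is_lim_seq_spec in H. intros eps.
    destruct (H eps) as [N HN]. exists N. intros n Hn.
    specialize (HN n Hn).
    rewrite Rminus_0_r, (Rabs_pos_eq _ (Cmod_ge_0 _)) in HN. exact HN.
Qed.

Lemma is_series_of_error_bound (a : nat -> C) (l : C) (b : nat -> R) :
  (forall N, (Cmod (sum_n a N - l) <= b N)%R) -> is_lim_seq b 0 ->
  is_series a l.
Proof.
  intros Hab Hb. apply is_series_Cmod.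
  apply (is_lim_seq_le_le (fun _ => 0%R) _ b).
  - intros n. split; [apply Cmod_ge_0 | apply Hab].
  - apply is_lim_seq_const.
  - exact Hb.
Qed.

Lemma Cmod_sum_n_le (a : nat -> C) (b : nat -> R) (N : nat) :
  (forall n, (Cmod (a n) <= b n)%R) -> (Cmod (sum_n a N) <= sum_n b N)%R.
Proof.
  intros H. induction N as [|N IH].
  - rewrite !sum_O. apply H.
  - rewrite !sum_Sn. eapply Rle_trans; [apply Cmod_triangle|].
    apply Rplus_le_compat; [exact IH | apply H].
Qed.

Lemma is_series_Cmod_le (a : nat -> C) (b : nat -> R) (l : C) (s : R) :
  (forall n, (Cmod (a n) <= b n)%R) -> is_series a l -> is_series b s ->
  (Cmod l <= s)%R.
Proof.
  intros Hab Ha Hb. apply is_series_Cmod in Ha.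
  assert (H : Rbar_le (Cmod l) (s + 0)%R).
  { apply (is_lim_seq_le (fun _ => Cmod l)
             (fun N => sum_n b N + Cmod (sum_n a N - l))%R).
    - intros N.
      replace l with (sum_n a N + - (sum_n a N - l)) at 1 by ring.
      eapply Rle_trans; [apply Cmod_triangle|]. rewrite Cmod_opp.
      apply Rplus_le_compat_r, Cmod_sum_n_le, Hab.
    - apply is_lim_seq_const.
    - apply is_lim_seq_plus'; [exact Hb | exact Ha]. }
  simpl in H. lra.
Qed.

Lemma is_series_tail (a : nat -> C) (l : C) (N : nat) :
  is_series a l -> is_series (fun k => a (S N + k)%nat) (l - sum_n a N).
Proof.
  intros H. apply (is_series_incr_n a (S N)); [lia|].
  simpl pred.
  match goal with |- is_series _ ?t => replace t with l; [exact H|] end.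
  change (l = (l - sum_n a N) + sum_n a N). ring.
Qed.

Lemma is_series_error_le (a : nat -> C) (b : nat -> R) (l : C) (s : R) (N : nat) :
  (forall n, (Cmod (a n) <= b n)%R) -> is_series a l -> is_series b s ->
  (Cmod (sum_n a N - l) <= s - sum_n b N)%R.
Proof.
  intros Hab Ha Hb.
  replace (sum_n a N - l) with (- (l - sum_n a N)) by ring. rewrite Cmod_opp.
  apply (is_series_Cmod_le (fun k => a (S N + k)%nat) (fun k => b (S N + k)%nat)).
  - intros k. apply Hab.
  - apply is_series_tail, Ha.
  - apply is_series_incr_n; [lia|]. simpl pred.
    match goal with |- is_series _ ?t => replace t with s; [exact Hb|] end.
    change (s = (s - sum_n b N) + sum_n b N)%R. ring.
Qed.

Lemma is_series_CSeries (a : nat -> C) : ex_series a -> is_series a (CSeries a).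
Proof.
  intros [l Hl]. rewrite (is_series_CSeries_unique a l Hl). exact Hl.
Qed.

Lemma ex_series_Cmod_le (a : nat -> C) (b : nat -> R) :
  (forall n, (Cmod (a n) <= b n)%R) -> ex_series b -> ex_series a.
Proof.
  intros H Hb. apply (@ex_series_le C_AbsRing C_CompleteNormedModule a b); auto.
Qed.

Lemma CSeries_ext (a b : nat -> C) :
  (forall n, a n = b n) -> CSeries a = CSeries b.
Proof.
  intros H. f_equal. apply functional_extensionality, H.
Qed.

Lemma CSeries_scal (c : C) (a : nat -> C) :
  ex_series a -> CSeries (fun n => c * a n) = c * CSeries a.
Proof.
  intros Ha. apply is_series_CSeries_unique.
  apply (is_series_scal c a), is_series_CSeries, Ha.
Qed.

(** Fubini for terms dominated by a product: cutting the outer sum at [N]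
    allows a finite exchange, and the discarded part is at most the tail of
    [b] beyond [N] times the sum of [c]. *)
Lemma CSeries_exchange (a : nat -> nat -> C) (b c : nat -> R) :
  (forall n m, (Cmod (a n m) <= b n * c m)%R) -> ex_series b -> ex_series c ->
  CSeries (fun n => CSeries (fun m => a n m))
  = CSeries (fun m => CSeries (fun n => a n m)).
Proof.
  intros Habc [B HB] [D HD].
  assert (HBm : forall m, is_series (fun n => b n * c m)%R (B * c m)%R).
  { intros m. apply (is_series_scal_r (c m) b B HB). }
  assert (Hrow : forall n, is_series (fun m => a n m) (CSeries (fun m => a n m))).
  { intros n. apply is_series_CSeries.
    apply (ex_series_Cmod_le _ (fun m => b n * c m)%R); [apply Habc|].
    exists (b n * D)%R. apply (is_series_scal_l (b n) c D HD). }
  assert (Hcol : forall m, is_series (fun n => a n m) (CSeries (fun n => a n m))).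
  { intros m. apply is_series_CSeries.
    apply (ex_series_Cmod_le _ (fun n => b n * c m)%R); [intros; apply Habc|].
    exists (B * c m)%R. apply HBm. }
  set (row := fun n => CSeries (fun m => a n m)) in *.
  set (col := fun m => CSeries (fun n => a n m)) in *.
  assert (Htot : is_series col (CSeries col)).
  { apply is_series_CSeries. apply (ex_series_Cmod_le _ (fun m => B * c m)%R).
    - intros m. apply (is_series_Cmod_le (fun n => a n m) (fun n => b n * c m)%R).
      + intros n. apply Habc.
      + apply Hcol.
      + apply HBm.
    - exists (B * D)%R. apply (is_series_scal_l B c D HD). }
  assert (Hpart : forall N,
    is_series (fun m => sum_n (fun n => a n m) N) (sum_n row N)).
  { induction N as [|N IH].
    - rewrite sum_O. apply (is_series_ext (fun m => a O m)); [|apply Hrow].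
      intros m. rewrite sum_O. reflexivity.
    - rewrite sum_Sn.
      apply (is_series_ext (fun m => plus (sum_n (fun n => a n m) N) (a (S N) m))).
      + intros m. rewrite sum_Sn. reflexivity.
      + apply (is_series_plus _ _ _ _ IH (Hrow (S N))). }
  apply is_series_CSeries_unique.
  apply (is_series_of_error_bound _ _ (fun N => (B - sum_n b N) * D)%R).
  - intros N.
    apply (is_series_Cmod_le (fun m => sum_n (fun n => a n m) N - col m)
             (fun m => (B - sum_n b N) * c m)%R).
    + intros m.
      replace ((B - sum_n b N) * c m)%R
        with (B * c m - sum_n (fun n => b n * c m)%R N)%R.
      * apply (is_series_error_le (fun n => a n m)); auto.
      * rewrite (sum_n_mult_r (c m) b N : sum_n (fun n => b n * c m)%R N = _).
        change (B * c m - sum_n b N * c m = (B - sum_n b N) * c m)%R. ring.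
    + apply (is_series_minus _ _ _ _ (Hpart N) Htot).
    + apply (is_series_scal_l (B - sum_n b N)%R c D HD).
  - replace (Finite 0) with (Finite ((B - B) * D)) by (f_equal; ring).
    apply is_lim_seq_mult'; [|apply is_lim_seq_const].
    apply is_lim_seq_minus'; [apply is_lim_seq_const | exact HB].
Qed.

(** * Tails of series and the two triangles of a square *)

Lemma is_series_shift (v : nat -> C) (n : nat) :
  ex_series v -> is_series (fun k => v (n + k)%nat) (CSeries_from n v).
Proof.
  intros Hv. apply is_series_CSeries. apply (ex_series_incr_n v n), Hv.
Qed.

Lemma CSeries_from_S (v : nat -> C) (n : nat) :
  ex_series v -> CSeries_from (S n) v = CSeries_from n v - v n.
Proof.
  intros Hv. apply is_series_CSeries_unique.
  apply (is_series_ext (fun k => v (n + S k)%nat)).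
  { intros k. f_equal. lia. }
  apply (is_series_incr_1 (fun k => v (n + k)%nat)).
  match goal with |- is_series _ ?t => replace t with (CSeries_from n v) end.
  - apply is_series_shift, Hv.
  - change (CSeries_from n v = (CSeries_from n v - v n) + v (n + 0)%nat).
    rewrite Nat.add_0_r. ring.
Qed.

Lemma CSeries_from_lim (v : nat -> C) :
  ex_series v -> is_lim_seq (fun N => Cmod (CSeries_from (S N) v)) 0.
Proof.
  intros Hv. pose proof (is_series_CSeries v Hv) as H.
  apply is_lim_seq_ext with (fun N => Cmod (sum_n v N - CSeries v)).
  - intros N. unfold CSeries_from.
    rewrite (is_series_CSeries_unique _ _ (is_series_tail v _ N H)).
    rewrite <- Cmod_opp. f_equal. ring.
  - apply is_series_Cmod, H.
Qed.

Lemma Cmod_CSeries_from_le (v : nat -> C) (n : nat) :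
  ex_series (fun n => Cmod (v n)) ->
  (Cmod (CSeries_from n v) <= Series (fun n => Cmod (v n)))%R.
Proof.
  intros Hv.
  assert (Hn : ex_series (fun k => Cmod (v (n + k)%nat))).
  { apply (ex_series_incr_n (fun k => Cmod (v k)) n), Hv. }
  apply Rle_trans with (Series (fun k => Cmod (v (n + k)%nat))).
  - apply (is_series_Cmod_le (fun k => v (n + k)%nat) (fun k => Cmod (v (n + k)%nat))).
    + intros k. apply Rle_refl.
    + apply is_series_shift. apply (ex_series_Cmod_le _ _ (fun n => Rle_refl _) Hv).
    + apply Series_correct, Hn.
  - destruct n as [|n]; [apply Rle_refl|].
    rewrite (Series_incr_n (fun k => Cmod (v k)) (S n)); [|lia|exact Hv].
    assert (0 <= sum_f_R0 (fun k => Cmod (v k)) (pred (S n)))%R.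
    { apply cond_pos_sum. intros k. apply Cmod_ge_0. }
    lra.
Qed.

Lemma ex_series_mul_tail (u v : nat -> C) :
  ex_series (fun n => Cmod (u n)) -> ex_series (fun n => Cmod (v n)) ->
  ex_series (fun n => u n * CSeries_from n v).
Proof.
  intros Hu Hv.
  apply (ex_series_Cmod_le _ (fun n => Cmod (u n) * Series (fun n => Cmod (v n)))%R).
  - intros n. rewrite Cmod_mult. apply Rmult_le_compat_l; [apply Cmod_ge_0|].
    apply Cmod_CSeries_from_le, Hv.
  - apply (ex_series_scal_r _ _ Hu).
Qed.

(** The square of all pairs [(n, m)] is peeled off in hooks, row [n] and column
    [n] from the diagonal onwards; the hook sums telescope because
    [u n = U n - U (n+1)] and [v n = T n - T (n+1)] for the tails [U], [T]. *)
Lemma CSeries_triangles (u v : nat -> C) :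
  ex_series (fun n => Cmod (u n)) -> ex_series (fun n => Cmod (v n)) ->
  CSeries (fun n => u n * CSeries_from n v) + CSeries (fun n => v n * CSeries_from n u)
  = CSeries u * CSeries v + CSeries (fun n => u n * v n).
Proof.
  intros Hu Hv.
  assert (Hu' : ex_series u) by apply (ex_series_Cmod_le _ _ (fun n => Rle_refl _) Hu).
  assert (Hv' : ex_series v) by apply (ex_series_Cmod_le _ _ (fun n => Rle_refl _) Hv).
  set (U := fun n => CSeries_from n u). set (T := fun n => CSeries_from n v).
  pose proof (is_series_CSeries _ (ex_series_mul_tail u v Hu Hv)) as HuT.
  pose proof (is_series_CSeries _ (ex_series_mul_tail v u Hv Hu)) as HvS.
  assert (Hdiag : is_series (fun n => u n * T n + v n * U n - u n * v n)
                    (CSeries u * CSeries v)).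
  { apply (is_series_of_error_bound _ _
      (fun N => Series (fun n => Cmod (u n)) * Cmod (T (S N)))%R).
    - intros N.
      assert (Htel : sum_n (fun n => u n * T n + v n * U n - u n * v n) N
                     = U O * T O - U (S N) * T (S N) :> C).
      { unfold U, T. induction N as [|N IH].
        - rewrite sum_n_0_C, !CSeries_from_S by assumption. ring.
        - rewrite sum_n_S_C, IH.
          rewrite (CSeries_from_S _ (S N)), (CSeries_from_S v (S N))
            by assumption.
          ring. }
      rewrite Htel. change (U O) with (CSeries u). change (T O) with (CSeries v).
      replace (CSeries u * CSeries v - U (S N) * T (S N)
               - CSeries u * CSeries v)
        with (- (U (S N) * T (S N))) by ring.
      rewrite Cmod_opp, Cmod_mult. apply Rmult_le_compat_r; [apply Cmod_ge_0|].
      apply Cmod_CSeries_from_le, Hu.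
    - rewrite <- (Rmult_0_r (Series (fun n => Cmod (u n)))).
      apply is_lim_seq_mult'; [apply is_lim_seq_const|].
      apply CSeries_from_lim, Hv'. }
  assert (Huv : is_series (fun n => u n * v n)
    (CSeries (fun n => u n * T n) + CSeries (fun n => v n * U n)
     - CSeries u * CSeries v)).
  { apply (is_series_ext (fun n => (u n * T n + v n * U n)
             - (u n * T n + v n * U n - u n * v n))).
    { intros n. match goal with |- ?a = ?b => change (@eq C a b) end. ring. }
    apply (is_series_minus (fun n => u n * T n + v n * U n) _ _ _); [|exact Hdiag].
    apply (is_series_plus (fun n => u n * T n) (fun n => v n * U n) _ _ HuT HvS). }
  rewrite (is_series_CSeries_unique _ _ Huv). unfold U, T. ring.
Qed.

(** * Lambert series *)

Lemma one_minus_neq_0 (c : C) : (Cmod c < 1)%R -> 1 - c <> 0.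
Proof.
  intros Hc H. replace c with (1 - (1 - c)) in Hc by ring.
  rewrite H in Hc. replace (1 - 0) with (RtoC 1) in Hc by ring.
  rewrite Cmod_1 in Hc. lra.
Qed.

Lemma is_series_Cgeom (c : C) :
  (Cmod c < 1)%R -> is_series (fun n => c ^ n) (/ (1 - c)).
Proof.
  intros Hc.
  assert (Hne : 1 - c <> 0) by apply one_minus_neq_0, Hc.
  assert (Hgeom : forall N, sum_n (fun n => c ^ n) N - / (1 - c)
                            = - (c ^ S N * / (1 - c))).
  { induction N as [|N IH].
    - rewrite sum_n_0_C. simpl. field. exact Hne.
    - rewrite sum_n_S_C.
      replace (sum_n (fun n => c ^ n) N + c ^ S N - / (1 - c))
        with ((sum_n (fun n => c ^ n) N - / (1 - c)) + c ^ S N) by ring.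
      rewrite IH. simpl. field. exact Hne. }
  apply (is_series_of_error_bound _ _ (fun N => Cmod c ^ S N * Cmod (/ (1 - c)))%R).
  - intros N. rewrite Hgeom, Cmod_opp, Cmod_mult, Cmod_pow. apply Rle_refl.
  - rewrite <- (Rmult_0_l (Cmod (/ (1 - c)))).
    apply is_lim_seq_mult'; [|apply is_lim_seq_const].
    apply (is_lim_seq_incr_1 (fun n => Cmod c ^ n)%R), is_lim_seq_geom.
    rewrite Rabs_pos_eq by apply Cmod_ge_0. exact Hc.
Qed.

Lemma ex_series_Cmod_geom (c : C) :
  (Cmod c < 1)%R -> ex_series (fun n => Cmod c ^ n)%R.
Proof.
  intros Hc. apply ex_series_geom. rewrite Rabs_pos_eq by apply Cmod_ge_0. exact Hc.
Qed.

Lemma Cmod_mul_pow_le (w q : C) (n : nat) :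
  (Cmod q < 1)%R -> (Cmod (w * q ^ n) <= Cmod w)%R.
Proof.
  intros Hq. rewrite Cmod_mult, Cmod_pow. pose proof (Cmod_ge_0 q).
  rewrite <- (Rmult_1_r (Cmod w)) at 2.
  apply Rmult_le_compat_l; [apply Cmod_ge_0|].
  rewrite <- (pow1 n). apply pow_incr. lra.
Qed.

(** As [w q^n -> 0], the denominators are eventually at least 1/2 in modulus,
    so the terms are eventually dominated by [2 |x|^n]. *)
Lemma ex_series_lambert_abs (q x w : C) :
  (Cmod q < 1)%R -> (Cmod x < 1)%R ->
  ex_series (fun n => Cmod (x ^ n / (1 - w * q ^ n))).
Proof.
  intros Hq Hx.
  assert (Hlim : is_lim_seq (fun n => Cmod (w * q ^ n)) 0).
  { apply is_lim_seq_ext with (fun n => Cmod w * Cmod q ^ n)%R.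
    { intros n. rewrite Cmod_mult, Cmod_pow. reflexivity. }
    rewrite <- (Rmult_0_r (Cmod w)).
    apply is_lim_seq_mult'; [apply is_lim_seq_const|]. apply is_lim_seq_geom.
    rewrite Rabs_pos_eq by apply Cmod_ge_0. exact Hq. }
  apply is_lim_seq_spec in Hlim.
  assert (Hhalf : (0 < 1 / 2)%R) by lra.
  destruct (Hlim (mkposreal _ Hhalf)) as [N HN]. simpl in HN.
  apply (ex_series_incr_n _ N).
  apply (@ex_series_le R_AbsRing R_CompleteNormedModule _
           (fun n => Cmod x ^ (N + n) * 2)%R).
  - intros n. specialize (HN (N + n)%nat ltac:(lia)).
    rewrite Rminus_0_r, (Rabs_pos_eq _ (Cmod_ge_0 _)) in HN.
    match goal with |- (norm ?t <= _)%R => change (norm t) with (Rabs t) end.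
    rewrite (Rabs_pos_eq _ (Cmod_ge_0 _)).
    set (d := w * q ^ (N + n)) in *.
    assert (Hd : (1 / 2 <= Cmod (1 - d))%R).
    { pose proof (Cmod_triangle (1 - d) d) as H.
      replace (1 - d + d) with (RtoC 1) in H by ring. rewrite Cmod_1 in H. lra. }
    assert (Hne : 1 - d <> 0).
    { intros H. rewrite H, Cmod_0 in Hd. lra. }
    rewrite Cmod_div, Cmod_pow by exact Hne.
    apply Rmult_le_compat_l; [apply pow_le, Cmod_ge_0|].
    replace 2%R with (/ (1 / 2))%R by lra.
    apply Rinv_le_contravar; lra.
  - apply (ex_series_scal_r 2 (fun n => Cmod x ^ (N + n))%R).
    apply (ex_series_incr_n (fun n => Cmod x ^ n)%R N), ex_series_Cmod_geom, Hx.
Qed.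

Lemma ex_series_lambert (q x w : C) :
  (Cmod q < 1)%R -> (Cmod x < 1)%R ->
  ex_series (fun n => x ^ n / (1 - w * q ^ n)).
Proof.
  intros Hq Hx.
  apply (ex_series_Cmod_le _ _ (fun n => Rle_refl _) (ex_series_lambert_abs q x w Hq Hx)).
Qed.

Lemma lambert1_E (q x w : C) :
  lambert q x [w] = CSeries (fun n => x ^ n / (1 - w * q ^ n)).
Proof.
  apply CSeries_ext. intros n. simpl. rewrite Cmult_1_r. reflexivity.
Qed.

(** The expansion has the exponent [n * m], symmetric in the two indices: this
    is the source of [lambert1_sym]. *)
Lemma lambert1_double_series (q x y : C) :
  (Cmod q < 1)%R -> (Cmod y < 1)%R ->
  lambert q x [y] = CSeries (fun n => CSeries (fun m => x ^ n * y ^ m * q ^ (n * m))).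
Proof.
  intros Hq Hy. rewrite lambert1_E. apply CSeries_ext. intros n.
  symmetry. apply is_series_CSeries_unique.
  apply (is_series_ext (fun m => scal (x ^ n) ((y * q ^ n) ^ m))).
  { intros m. rewrite Cpow_mult_l, <- Cpow_mult_r. apply Cmult_assoc. }
  apply (is_series_scal (V := C_NormedModule) (x ^ n) _ (/ (1 - y * q ^ n))), is_series_Cgeom.
  eapply Rle_lt_trans; [apply Cmod_mul_pow_le, Hq | exact Hy].
Qed.

Lemma lambert1_sym (q x y : C) :
  (Cmod q < 1)%R -> (Cmod x < 1)%R -> (Cmod y < 1)%R ->
  lambert q x [y] = lambert q y [x].
Proof.
  intros Hq Hx Hy. rewrite !lambert1_double_series by assumption.
  rewrite (CSeries_exchange _ (fun n => Cmod x ^ n)%R (fun m => Cmod y ^ m)%R).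
  - apply CSeries_ext. intros m. apply CSeries_ext. intros n.
    rewrite Nat.mul_comm. ring.
  - intros n m. eapply Rle_trans; [apply Cmod_mul_pow_le, Hq|].
    rewrite Cmod_mult, !Cmod_pow. apply Rle_refl.
  - apply ex_series_Cmod_geom, Hx.
  - apply ex_series_Cmod_geom, Hy.
Qed.

(** * Double Lambert series *)

Lemma double_lambert_factor (q x y z w : C) :
  (Cmod q < 1)%R -> (Cmod y < 1)%R ->
  (forall n, 1 - w * q ^ n <> 0) -> (forall n, 1 - z * q ^ n <> 0) ->
  double_lambert q x y z w
  = CSeries (fun n => x ^ n / (1 - w * q ^ n)
                      * CSeries_from n (fun m => y ^ m / (1 - z * q ^ m))).
Proof.
  intros Hq Hy Hw Hz. apply CSeries_ext. intros n. unfold CSeries_from.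
  rewrite <- CSeries_scal.
  - apply CSeries_ext. intros k. field. split; auto.
  - apply (ex_series_incr_n (fun m => y ^ m / (1 - z * q ^ m)) n).
    apply ex_series_lambert; assumption.
Qed.

(** Shifting the summation index by [n] acts on the parameter as
    [z -> z q^n]. *)
Lemma lambert_tail (q y z : C) (n : nat) :
  (Cmod q < 1)%R -> (Cmod y < 1)%R ->
  CSeries_from n (fun m => y ^ m / (1 - z * q ^ m)) = y ^ n * lambert q y [z * q ^ n].
Proof.
  intros Hq Hy. rewrite lambert1_E, <- CSeries_scal by (apply ex_series_lambert; assumption).
  apply CSeries_ext. intros k. rewrite !Cpow_add_r, <- Cmult_assoc with (x := z).
  unfold Cdiv. ring.
Qed.

Lemma double_lambert_lambert (q x y z w : C) :
  (Cmod q < 1)%R -> (Cmod y < 1)%R ->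
  (forall n, 1 - w * q ^ n <> 0) -> (forall n, 1 - z * q ^ n <> 0) ->
  double_lambert q x y z w
  = CSeries (fun n => (x * y) ^ n / (1 - w * q ^ n) * lambert q y [z * q ^ n]).
Proof.
  intros Hq Hy Hw Hz. rewrite double_lambert_factor by assumption.
  apply CSeries_ext. intros n. rewrite lambert_tail, Cpow_mult_l by assumption.
  unfold Cdiv. ring.
Qed.

(** After symmetrising the inner Lambert series on both sides, each side is the
    same double series of [A n * B m * q^(n m)], summed in opposite orders; the
    factor [q^(n m)] can be absorbed either in [z^m] or in [(x y)^n]. *)
Lemma double_lambert_transform (q x y z w : C) :
  (Cmod q < 1)%R -> w <> 0 -> (Cmod (x * y) < 1)%R -> (Cmod y < 1)%R ->
  (Cmod z < 1)%R -> (Cmod w < 1)%R ->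
  double_lambert q x y z w = double_lambert q (z / w) w (x * y) y.
Proof.
  intros Hq Hw0 Hxy Hy Hz Hw.
  assert (Hlt : forall c n, (Cmod c < 1)%R -> (Cmod (c * q ^ n) < 1)%R).
  { intros c n Hc. eapply Rle_lt_trans; [apply Cmod_mul_pow_le, Hq | exact Hc]. }
  assert (Hden : forall c n, (Cmod c < 1)%R -> 1 - c * q ^ n <> 0).
  { intros c n Hc. apply one_minus_neq_0, Hlt, Hc. }
  rewrite !double_lambert_lambert by auto.
  replace (z / w * w) with z by (field; exact Hw0).
  set (A := fun n => (x * y) ^ n / (1 - w * q ^ n)).
  set (B := fun n => z ^ n / (1 - y * q ^ n)).
  transitivity (CSeries (fun n => CSeries (fun m => A n * B m * q ^ (n * m)))).
  { apply CSeries_ext. intros n. rewrite lambert1_sym, lambert1_E by auto.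
    rewrite <- CSeries_scal by (apply ex_series_lambert; auto).
    apply CSeries_ext. intros m.
    rewrite (Cpow_mult_l z), <- Cpow_mult_r. unfold A, B, Cdiv. ring. }
  rewrite (CSeries_exchange _ (fun n => Cmod (A n)) (fun m => Cmod (B m))).
  - apply CSeries_ext. intros m. rewrite lambert1_sym, lambert1_E by auto.
    rewrite <- CSeries_scal by (apply ex_series_lambert; auto).
    apply CSeries_ext. intros n.
    rewrite (Cpow_mult_l (x * y)), <- Cpow_mult_r, (Nat.mul_comm m n).
    unfold A, B, Cdiv. ring.
  - intros n m. eapply Rle_trans; [apply Cmod_mul_pow_le, Hq|].
    rewrite Cmod_mult. apply Rle_refl.
  - apply ex_series_lambert_abs; assumption.
  - apply ex_series_lambert_abs; assumption.
Qed.

Lemma double_lambert_reflection (q x y z w : C) :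
  (Cmod q < 1)%R -> (Cmod x < 1)%R -> (Cmod y < 1)%R ->
  (forall n, 1 - w * q ^ n <> 0) -> (forall n, 1 - z * q ^ n <> 0) ->
  double_lambert q x y z w + double_lambert q y x w z
  = lambert q x [w] * lambert q y [z] + lambert q (x * y) [z; w].
Proof.
  intros Hq Hx Hy Hw Hz. rewrite !double_lambert_factor by assumption.
  rewrite (CSeries_triangles (fun n => x ^ n / (1 - w * q ^ n))
             (fun n => y ^ n / (1 - z * q ^ n)))
    by (apply ex_series_lambert_abs; assumption).
  rewrite !lambert1_E. f_equal. apply CSeries_ext. intros n. simpl.
  rewrite Cpow_mult_l. field. split; auto.
Qed.

Theorem proposition2p1 (q x y z w : C) (hq : (0 < Cmod q < 1)%R) :
  (w <> 0 -> (Cmod (x * y) < 1)%R -> (Cmod y < 1)%R ->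
   (Cmod z < 1)%R -> (Cmod w < 1)%R ->
   double_lambert q x y z w = double_lambert q (z / w) w (x * y) y)
  /\
  ((Cmod x < 1)%R -> (Cmod y < 1)%R ->
   (forall r : nat, z <> / q ^ r) -> (forall r : nat, w <> / q ^ r) ->
   double_lambert q x y z w + double_lambert q y x w z
     = lambert q x [w] * lambert q y [z] + lambert q (x * y) [z; w]).
Proof.
  destruct hq as [Hq0 Hq].
  assert (Hden : forall c : C, (forall r, c <> / q ^ r) -> forall n, 1 - c * q ^ n <> 0).
  { intros c Hc n H. apply (Hc n).
    assert (Hqn : q ^ n <> 0) by (apply Cpow_nz, Cmod_gt_0, Hq0).
    replace c with ((1 - (1 - c * q ^ n)) / q ^ n) by (field; exact Hqn).
    rewrite H. field. exact Hqn. }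
  split.
  - intros Hw0 Hxy Hy Hz Hw. apply double_lambert_transform; assumption.
  - intros Hx Hy Hz Hw. apply double_lambert_reflection; auto.
Qed.
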